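(* Let $A,B,C$ be three distinct points of $\mathbb{R}^2$ not lying on one line, and let $x,y$ be two closed discs in $\mathbb{R}^2$ (a disc of radius $0$, i.e. a single point, is allowed) such that $x\subseteq \mathrm{conv}\{A,B,C\}$ and $y\subseteq \mathrm{conv}\{A,B,C\}$. Then there exist $U,V\in\{A,B,C\}$ such that either $x\subseteq \mathrm{conv}(y\cup\{U,V\})$ or $y\subseteq \mathrm{conv}(x\cup\{U,V\})$.
   Context: $\mathrm{conv}$ denotes the usual convex hull in $\mathbb{R}^2$. ''Circles'' in the paper are identified with closed discs (the set of points of the circle together with its interior); points are regarded as circles of radius zero. In the language of the paper, this is the statement that $x,y\in ch_c(\{A,B,C\})$ implies $x\in ch_c(\{y,U,V\})$ or $y\in ch_c(\{x,U,V\})$ for some $U,V\in\{A,B,C\}$, where for a set $Y$ of circles, a circle $z$ belongs to $ch_c(Y)$ iff $z\subseteq \mathrm{conv}(\bigcup_{w\in Y} w)$. *)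

(* Defs.v *)
From HB Require Import structures.
From mathcomp Require Import all_boot all_order all_algebra.
From mathcomp Require Import boolp classical_sets reals convex.

Set Implicit Arguments.
Unset Strict Implicit.
Unset Printing Implicit Defensive.

Import Order.TTheory GRing.Theory Num.Theory.

Local Open Scope classical_set_scope.
Local Open Scope ring_scope.

Definition convex_hull (R : realType) (E : lmodType R) (X : set E) : set E :=
  smallest (@convex_set R E) X.

(* The canonical norm on 'rV[R]_n is the sup norm, whose
   balls are squares, so the Euclidean norm is spelled out here. *)
Definition enorm (R : realType) (n : nat) (v : 'rV[R]_n) : R :=
  Num.sqrt (\sum_(i < n) v ord0 i ^+ 2).

Definition is_closed_disc (R : realType) (D : set 'rV[R]_2) : Prop :=
  exists (c : 'rV[R]_2) (r : R),
    0 <= r /\ D = [set p | enorm (p - c) <= r].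

Definition is_line (R : realType) (L : set 'rV[R]_2) : Prop :=
  exists p d : 'rV[R]_2, d != 0 /\ L = [set p + t *: d | t in [set: R]].

(* Main.v *)
Require Import Defs.
From HB Require Import structures.
From mathcomp Require Import all_boot all_order all_algebra.
From mathcomp Require Import boolp classical_sets reals convex.
From mathcomp Require Import interval_inference topology normedtype derive.
From mathcomp Require Import ring lra.

Set Implicit Arguments.
Unset Strict Implicit.
Unset Printing Implicit Defensive.

Import Order.TTheory GRing.Theory Num.Theory numFieldNormedType.Exports.

Local Open Scope classical_set_scope.
Local Open Scope ring_scope.

(* Compare support functions. Let [x] and [y] have centres [c], [c'] and radii
   [r <= r']. If [x] is not inside the hull of [y] and two vertices [U], [V],
   a separating direction [u] lies in the interior of the normal cone of the
   triangle at the third vertex, and in the convex cone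
   [K = {u | <u, c - c'> > (r' - r) |u|}], which does not contain [0]. If this
   happens at all three vertices, then [K] meets the three normal cones, and
   since it misses [0] it must contain two of the three outer normals of the
   sides, hence the whole interior of one normal cone. At the corresponding
   vertex no direction separates a point of [y] from the hull of [x] and the
   two other vertices. *)

(** * Euclidean inner product and norm *)

Section Dot.
Variables (R : realType) (n : nat).
Implicit Types u v w : 'rV[R]_n.

Definition dot u v : R := \sum_(i < n) u ord0 i * v ord0 i.

Lemma dotC u v : dot u v = dot v u.
Proof. by apply: eq_bigr => i _; rewrite mulrC. Qed.

Lemma dotDr u v w : dot u (v + w) = dot u v + dot u w.
Proof. by rewrite -big_split; apply: eq_bigr => i _; rewrite mxE mulrDr. Qed.

Lemma dotZr u a v : dot u (a *: v) = a * dot u v.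
Proof. by rewrite big_distrr; apply: eq_bigr => i _; rewrite mxE mulrCA. Qed.

Lemma dotNr u v : dot u (- v) = - dot u v.
Proof. by rewrite -scaleN1r dotZr mulN1r. Qed.

Lemma dot0l v : dot 0 v = 0.
Proof. by apply: big1 => i _; rewrite mxE mul0r. Qed.

Lemma dotDl u v w : dot (u + v) w = dot u w + dot v w.
Proof. by rewrite !(dotC _ w) dotDr. Qed.

Lemma dotZl a u v : dot (a *: u) v = a * dot u v.
Proof. by rewrite !(dotC _ v) dotZr. Qed.

Lemma dotNl u v : dot (- u) v = - dot u v.
Proof. by rewrite !(dotC _ v) dotNr. Qed.

Definition dotE := (dotDl, dotDr, dotNl, dotNr, dotZl, dotZr).

Lemma dot_ge0 u : 0 <= dot u u.
Proof. by apply: sumr_ge0 => i _; rewrite -expr2 sqr_ge0. Qed.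

Lemma dot_eq0 u : (dot u u == 0) = (u == 0).
Proof.
apply/eqP/eqP => [u0|->]; last exact: dot0l.
apply/rowP => i; rewrite mxE; apply/eqP; rewrite -sqrf_eq0 expr2.
move/eqP: u0; rewrite psumr_eq0 => [/allP/(_ i)|j _]; last first.
  by rewrite -expr2 sqr_ge0.
by rewrite mem_index_enum; apply.
Qed.

Lemma dot_gt0 u : (0 < dot u u) = (u != 0).
Proof. by rewrite lt_def dot_ge0 andbT dot_eq0. Qed.

Lemma enorm_dot u : enorm u = Num.sqrt (dot u u).
Proof. by congr Num.sqrt; apply: eq_bigr => i _; rewrite expr2. Qed.

Lemma enorm_ge0 u : 0 <= enorm u.
Proof. exact: sqrtr_ge0. Qed.

Lemma sqr_enorm u : enorm u * enorm u = dot u u.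
Proof. by rewrite enorm_dot -expr2 sqr_sqrtr// dot_ge0. Qed.

Lemma enorm_gt0 u : (0 < enorm u) = (u != 0).
Proof. by rewrite enorm_dot sqrtr_gt0 dot_gt0. Qed.

Lemma enorm0 : enorm (0 : 'rV[R]_n) = 0.
Proof. by apply/eqP; rewrite eq_le enorm_ge0 andbT leNgt enorm_gt0 eqxx. Qed.

Lemma enormZ a u : enorm (a *: u) = `|a| * enorm u.
Proof.
by rewrite !enorm_dot !dotE mulrA -expr2 sqrtrM ?sqr_ge0// sqrtr_sqr.
Qed.

(** Cauchy-Schwarz: the squared length of |v| u - |u| v is nonnegative and expands to 2 |u| |v| (|u|
    |v| - <u, v>). *)
Lemma le_dot_enorm u v : dot u v <= enorm u * enorm v.
Proof.
have [->|u0] := eqVneq u 0.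
  by rewrite dot0l mulr_ge0 ?enorm_ge0.
have [->|v0] := eqVneq v 0.
  by rewrite dotC dot0l mulr_ge0 ?enorm_ge0.
have := dot_ge0 (enorm v *: u - enorm u *: v).
move: u0 v0; rewrite -!enorm_gt0 !dotE -!sqr_enorm (dotC v u) => u0 v0.
set a := enorm u in u0 *; set b := enorm v in v0 * => H.
rewrite -(ler_pM2l (mulr_gt0 u0 v0)); nra.
Qed.

Lemma enormD u v : enorm (u + v) <= enorm u + enorm v.
Proof.
rewrite -ler_sqr ?nnegrE ?addr_ge0 ?enorm_ge0// !expr2 sqr_enorm !dotE.
by rewrite (dotC v u) -!sqr_enorm; have := le_dot_enorm u v; nra.
Qed.

End Dot.

(** * Convex sets and hulls *)

Lemma convex_setP (R : realType) (E : lmodType R) (X : set E) :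
  @convex_set R E X <-> forall (p q : E) (t : R), 0 <= t -> t <= 1 ->
    X p -> X q -> X (t *: p + (1 - t) *: q).
Proof.
split=> [cX p q t t0 t1 Xp Xq|cX p q t].
  by have := cX p q (Itv01 t0 t1); rewrite !in_setE => /(_ Xp Xq).
by rewrite !in_setE => Xp Xq; apply: cX.
Qed.

Lemma convex_hull_convex (R : realType) (E : lmodType R) (X : set E) :
  @convex_set R E (convex_hull X).
Proof.
apply/convex_setP => p q t t0 t1 Xp Xq Y [/= cY XY].
by move/convex_setP: (cY); apply=> //; [exact: Xp|exact: Xq].
Qed.

(** A closed half-space is convex, so it contains the hull of each of its subsets. *)
Lemma dot_hull_le (R : realType) n (u : 'rV[R]_n) (M : R) (X : set 'rV[R]_n) p :
  (forall q, X q -> dot u q <= M) -> convex_hull X p -> dot u p <= M.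
Proof.
move=> XM; apply: (@smallest_sub _ _ _ [set q | dot u q <= M]) => //.
by apply/convex_setP => /= q r t t0 t1 qM rM; rewrite !dotE; nra.
Qed.

(** * Strict separation from compact convex sets *)

Section Separation.
Variables (R : realType) (n : nat).

Lemma dot_continuous (z : 'rV[R]_n) :
  continuous (fun p : 'rV[R]_n => dot (z - p) (z - p) : R).
Proof.
have h i : continuous (fun q : 'rV[R]_n => (z - q) ord0 i : R).
  under eq_fun do rewrite !mxE.
  move=> p; apply: (@continuousB R R^o 'rV[R]_n); first exact: cst_continuous.
  exact: coord_continuous.
move=> p; apply: cvg_big => [||i _].
- exact: add_continuous.
- exact: nbhs_filter.
- by apply: (@continuousM R 'rV[R]_n); exact: h.
Qed.

(** The direction is [z - p] for a point [p] of [X] nearest to [z]: a point of [X] further along it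
    would allow a step from [p] closer to [z]. *)
Lemma compact_convex_separation (X : set 'rV[R]_n) (z : 'rV[R]_n) :
  X !=set0 -> compact X -> @convex_set R _ X -> ~ X z ->
  exists u : 'rV[R]_n, forall p, X p -> dot u p < dot u z.
Proof.
move=> X0 cX /convex_setP vX Xz.
have [|p Xp pmin] :=
  compact_EVT_min (f := fun p : 'rV[R]_n => dot (z - p) (z - p)) X0 cX.
  by apply: continuous_subspaceT; exact: dot_continuous.
rewrite in_setE in Xp.
exists (z - p) => q Xq.
have zp : 0 < dot (z - p) (z - p).
  by rewrite dot_gt0 subr_eq0; apply/eqP => zp; apply: Xz; rewrite zp.
suff : dot (z - p) (q - p) <= 0.
  by move: zp; rewrite [_ (q - p)]dotDr [X in 0 < X]dotDr !(dotNr _ p); lra.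
rewrite leNgt; apply/negP => d0.
set d := dot _ _ in d0; pose e := dot (q - p) (q - p).
(* Moving from [p] towards [q] by [t] changes the squared distance
   to [z] by [t ^ 2 * e - 2 * t * d]. *)
have key t : 0 <= t -> t <= 1 -> 2 * t * d <= t * t * e.
  move=> t0 t1; have := pmin (t *: q + (1 - t) *: p).
  rewrite in_setE => /(_ (vX _ _ _ t0 t1 Xq Xp)).
  have -> : z - (t *: q + (1 - t) *: p) = (z - p) - t *: (q - p).
    by apply/rowP => i; rewrite !mxE; ring.
  rewrite (dotDl (z - p)) !(dotDr _ (z - p)) !(dotNl, dotNr, dotZl, dotZr).
  by rewrite (dotC (q - p) (z - p)) -/d -/e; lra.
have e0 : 0 <= e by exact: dot_ge0.
(* This step length stays in (0, 1] without comparing [d] and [e]. It satisfies t e = d - t d, so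
   [key] would give 2 t d <= t (d - t d) < t d. *)
have t1 : d / (d + e) <= 1 by rewrite ler_pdivrMr; lra.
have t0 : 0 < d / (d + e) by rewrite divr_gt0//; lra.
have := key _ (ltW t0) t1.
have : d / (d + e) * (d + e) = d by field; lra.
set t := d / (d + e) in t0 t1 * => td.
have -> : t * t * e = t * (d - t * d) by rewrite -[X in X - _]td; ring.
nra.
Qed.

(** The disc is closed, by continuity of the squared distance, and lies in a product of compact
    segments. *)
Lemma closed_disc_compact (c : 'rV[R]_n) (r : R) :
  compact [set p | enorm (p - c) <= r].
Proof.
have [r0|r0] := ltP r 0.
  rewrite (_ : [set p | _] = set0); first exact: compact0.
  apply/seteqP; split=> // p /= pr.
  by have := lt_le_trans r0 (le_trans (enorm_ge0 (p - c)) pr); rewrite ltxx.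
have dE p : (enorm (p - c) <= r) = (dot (c - p) (c - p) <= r * r).
  rewrite -(opprB p c) dotNl dotNr opprK -sqr_enorm -!expr2.
  by rewrite ler_sqr ?nnegrE ?enorm_ge0.
have coord p i : enorm (p - c) <= r -> `|p ord0 i - c ord0 i| <= r.
  move=> pr; rewrite -ler_sqr ?nnegrE// real_normK ?num_real//.
  have /le_trans -> // : (p ord0 i - c ord0 i) ^+ 2 <= enorm (p - c) ^+ 2.
    rewrite expr2 [leRHS]expr2 sqr_enorm /dot (bigD1 i)//= !mxE lerDl.
    by apply: sumr_ge0 => j _; rewrite -expr2 sqr_ge0.
  by rewrite ler_sqr ?nnegrE ?enorm_ge0.
apply: (@subclosed_compact _ _
    [set v : 'rV[R]_n | forall i,
      `[c ord0 i - r, c ord0 i + r]%classic (v ord0 i)]).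
- rewrite (_ : [set p | _] =
      (fun p => dot (c - p) (c - p)) @^-1` [set a | a <= r * r]).
    by apply: preimage_closed => [? _|]; [exact: dot_continuous|exact: closed_le].
  by apply/seteqP; split=> p /=; rewrite dE.
- apply: (@rV_compact _ _ (fun i => `[c ord0 i - r, c ord0 i + r]%classic)).
  by move=> i; exact: segment_compact.
- by move=> p /coord + i => /(_ i); rewrite /= in_itv/= ler_distl.
Qed.

Lemma closed_disc_convex (c : 'rV[R]_n) (r : R) :
  @convex_set R _ [set p | enorm (p - c) <= r].
Proof.
apply/convex_setP => p q t t0 t1 /= pr qr.
have -> : t *: p + (1 - t) *: q - c = t *: (p - c) + (1 - t) *: (q - c).
  by apply/rowP => i; rewrite !mxE; ring.
rewrite (le_trans (enormD _ _))// !enormZ !ger0_norm ?subr_ge0//; nra.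
Qed.

(** The union of the segments from [U] to points of [X], written as a continuous image of a product
    so that compactness passes from [X] to it. *)
Definition join_point (X : set 'rV[R]_n) (U : 'rV[R]_n) : set 'rV[R]_n :=
  (fun tp : R * 'rV[R]_n => tp.1 *: tp.2 + (1 - tp.1) *: U) @`
    (`[0, 1]%classic `*` X).

Lemma join_point_compact X U : compact X -> compact (join_point X U).
Proof.
move=> cX; apply: continuous_compact; last first.
  by apply: compact_setX => //; exact: segment_compact.
apply: continuous_subspaceT => -[t p]; apply: cvgD.
  by apply: cvgZ; [exact: cvg_fst|exact: cvg_snd].
by apply: cvgZ; [apply: cvgB; [exact: cvg_cst|exact: cvg_fst]|exact: cvg_cst].
Qed.

(** A combination gives the two points of [X] total weight [w]; dividing their weights by [w] merges
    them into one point of [X]. *)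
Lemma join_point_convex X U :
  @convex_set R _ X -> @convex_set R _ (join_point X U).
Proof.
move=> /convex_setP vX; apply/convex_setP => p' q' l l0 l1.
move=> [[t p] [/=]]; rewrite in_itv/= => /andP[t0 t1] Xp <-.
move=> [[s q] [/=]]; rewrite in_itv/= => /andP[s0 s1] Xq <-.
pose w := l * t + (1 - l) * s.
have lt0 : 0 <= l * t by rewrite mulr_ge0.
have ls0 : 0 <= (1 - l) * s by rewrite mulr_ge0// subr_ge0.
have w1 : w <= 1 by rewrite /w; nra.
(* Here the combination is [U] itself, and any point of [X] may carry weight 0. *)
have [w0|w0] := eqVneq w 0.
  exists (0, p) => /=; first by rewrite in_itv/= lexx ler01.
  have [a0 b0] : l * t = 0 /\ (1 - l) * s = 0 by move: w0; rewrite /w; lra.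
  apply/rowP => i; rewrite !mxE.
  transitivity (l * t * p ord0 i + (1 - l) * s * q ord0 i
    + (1 - l * t - (1 - l) * s) * U ord0 i); last by ring.
  by rewrite a0 b0; ring.
have {}w0 : 0 < w by rewrite lt_def w0 addr_ge0.
exists (w, (l * t / w) *: p + (1 - l * t / w) *: q) => /=.
  split; first by rewrite in_itv/= ltW.
  apply: vX => //; first by rewrite divr_ge0// ltW.
  by rewrite ler_pdivrMr// mul1r /w lerDl.
apply/rowP => i; rewrite !mxE; move: w0; rewrite /w => w0; field.
by rewrite gt_eqF.
Qed.

Lemma join_pointl (X : set 'rV[R]_n) U : X `<=` join_point X U.
Proof.
move=> p Xp; exists (1, p) => /=; first by rewrite in_itv/= lexx ler01.
by rewrite subrr scale0r addr0 scale1r.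
Qed.

Lemma join_pointr (X : set 'rV[R]_n) U : X !=set0 -> join_point X U U.
Proof.
move=> [p Xp]; exists (0, p) => /=; first by rewrite in_itv/= lexx ler01.
by rewrite subr0 scale0r add0r scale1r.
Qed.

Lemma join_point_sub_convex (X Y : set 'rV[R]_n) U :
  @convex_set R _ Y -> X `<=` Y -> Y U -> join_point X U `<=` Y.
Proof.
move=> /convex_setP vY XY YU _ [[t p] [/= + Xp] <-].
by rewrite in_itv/= => /andP[t0 t1]; apply: vY => //; exact: XY.
Qed.

(** Joining [X] to [U] and then to [V] gives a compact convex set inside the hull, which therefore
    misses [z] too and contains [X], [U] and [V]. *)
Lemma hull_point_separation (X : set 'rV[R]_n) (U V z : 'rV[R]_n) :
  X !=set0 -> compact X -> @convex_set R _ X ->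
  ~ convex_hull (X `|` [set U; V]) z ->
  exists u : 'rV[R]_n, [/\ dot u U < dot u z, dot u V < dot u z
    & forall p, X p -> dot u p < dot u z].
Proof.
move=> X0 cX vX Hz; pose Y := join_point (join_point X U) V.
have XY : X `<=` Y by move=> p /(@join_pointl _ U) /(@join_pointl _ V).
have YH : Y `<=` convex_hull (X `|` [set U; V]).
  have H := @sub_gen_smallest _ (@convex_set R _) (X `|` [set U; V]).
  apply: join_point_sub_convex; first exact: convex_hull_convex.
    apply: join_point_sub_convex; first exact: convex_hull_convex.
      by move=> p Xp; apply: H; left.
    by apply: H; right; left.
  by apply: H; right; right.
have [|||/YH //|u uY] := @compact_convex_separation Y z.
- by case: X0 => p /XY; exists p.
- by do 2 apply: join_point_compact.
- by do 2 apply: join_point_convex.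
exists u; split=> [||p /XY]; last exact: uY.
  by apply/uY/join_pointl/join_pointr.
by apply/uY/join_pointr; case: X0 => p /(@join_pointl _ U); exists p.
Qed.

End Separation.

(** * Escape directions of a disc, via support functions *)

Lemma disc_not_sub_hull (R : realType) n (T : set 'rV[R]_n)
    (c c' U V W : 'rV[R]_n) (r r' : R) :
  0 <= r' -> T `<=` [set U; V; W] ->
  [set p | enorm (p - c) <= r] `<=` convex_hull T ->
  ~ [set p | enorm (p - c) <= r] `<=`
      convex_hull ([set p | enorm (p - c') <= r'] `|` [set U; V]) ->
  exists u : 'rV[R]_n, [/\ dot u U < dot u W, dot u V < dot u W
    & (r' - r) * enorm u < dot u (c - c')].
Proof.
move=> r'0 TUVW xT /existsNP[z /not_implyP[zx zH]].
have [|||u [uU uV uy]] := hull_point_separation _ _ _ zH.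
- by exists c'; rewrite /= subrr enorm0.
- exact: closed_disc_compact.
- exact: closed_disc_convex.
(* Otherwise all of [T], hence its hull, would lie strictly below the level of [z], a point of that
   hull. *)
have zW : dot u z <= dot u W.
  have [//|Wz] := leP (dot u z) (dot u W).
  have [M Mz UVW] : exists2 M, M < dot u z &
      forall q, T q -> dot u q <= M.
    exists (Num.max (Num.max (dot u U) (dot u V)) (dot u W)).
      by rewrite !gt_max uU uV Wz.
    by move=> q /TUVW[[->|->]|->]; rewrite !le_max lexx ?orbT.
  by have := dot_hull_le UVW (xT _ zx); rewrite leNgt Mz.
exists u; split; [exact: lt_le_trans zW|exact: lt_le_trans zW|].
have u0 : 0 < enorm u.
  rewrite enorm_gt0; apply: contraTneq uU => ->.
  by rewrite !dot0l ltxx.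
(* The point of the second disc furthest along [u], at level <u, c'> + r' |u|. By Cauchy-Schwarz [z]
   is at level at most <u, c> + r |u|. *)
have := uy (c' + (r' / enorm u) *: u).
rewrite /= addrC addKr enormZ ger0_norm ?divr_ge0 ?enorm_ge0//.
rewrite divfK ?gt_eqF// => /(_ (lexx _)).
rewrite dotDr dotZr -sqr_enorm mulrA divfK ?gt_eqF//.
have := le_dot_enorm u (z - c); rewrite !dotDr !dotNr.
move: zx => /= zx; nra.
Qed.

(** * Convex cones that miss the origin *)

Section Cone.
Variables (R : realType) (n : nat) (K : set 'rV[R]_n).
Hypothesis K0 : ~ K 0.
Hypothesis KD : forall u v, K u -> K v -> K (u + v).
Hypothesis KZ : forall t u, 0 < t -> K u -> K (t *: u).

(** Scaling the two members by [a] and [b] and adding turns the [na] and [nb] terms into a multiple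
    of [nc]. The resulting coefficient [D] is nonzero because [K] misses 0, and its sign picks the
    side. *)
Lemma cone_line (na nb nc : 'rV[R]_n) (a b c c' : R) :
  na + nb + nc = 0 -> 0 < a -> 0 < b ->
  K (b *: nb + c *: nc) -> K (a *: na + c' *: nc) -> K nc \/ K (- nc).
Proof.
move=> n0 a0 b0 Kb Ka; pose D := a * c + b * c' - a * b.
have KDn : K (D *: nc).
  have -> : D *: nc = a *: (b *: nb + c *: nc) + b *: (a *: na + c' *: nc).
    have -> : na = - nb - nc.
      by apply/eqP; rewrite -subr_eq0 opprD !opprK addrA n0.
    by apply/rowP => i; rewrite !mxE /D; ring.
  by apply: KD; exact: KZ.
have [D0|D0|D0] := ltgtP D 0; last by case: K0; rewrite -(scale0r nc) -D0.
  right; have := KZ (t := - D^-1) _ KDn; rewrite scalerA mulNr mulVf ?lt_eqF//.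
  by rewrite scaleN1r; apply; rewrite oppr_gt0 invr_lt0.
left; have := KZ (t := D^-1) _ KDn; rewrite scalerA mulVf ?gt_eqF//.
by rewrite scale1r; apply; rewrite invr_gt0.
Qed.

(** By [cone_line], [K] contains each vector or its opposite. Two opposites would cancel the given
    positive combination of the same two vectors and put 0 in [K], so at most one sign is
    negative. *)
Lemma cone_two_rays (na nb nc : 'rV[R]_n) (a b c a' b' c' : R) :
  na + nb + nc = 0 ->
  0 < a -> 0 < b -> 0 < c -> 0 < a' -> 0 < b' -> 0 < c' ->
  K (b *: nb + c *: nc) -> K (a *: na + c' *: nc) -> K (a' *: na + b' *: nb) ->
  [\/ K nb /\ K nc, K na /\ K nc | K na /\ K nb].
Proof.
move=> n0 a0 b0 c0 a'0 b'0 c'0 KA KB KC.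
have cancel (s t : R) (p q : 'rV[R]_n) :
    0 < s -> 0 < t -> K (s *: p + t *: q) -> K (- p) -> K (- q) -> False.
  move=> s0 t0 Kpq Kp Kq; apply: K0.
  have := KD Kpq (KD (KZ s0 Kp) (KZ t0 Kq)).
  by rewrite !scalerN -opprD subrr.
have Kc := cone_line n0 a0 b0 KA KB.
have Kb : K nb \/ K (- nb).
  apply: (@cone_line na nc nb a' c b b') => //; last by rewrite addrC.
  by rewrite addrAC.
have Ka : K na \/ K (- na).
  by apply: (@cone_line nb nc na b' c' a a') => //; rewrite 1?addrC// addrA.
case: Ka Kb Kc => Ka [] Kb [] Kc.
- by constructor 1.
- by constructor 3.
- by constructor 2.
- by case: (cancel _ _ _ _ b0 c0 KA).
- by constructor 1.
- by case: (cancel _ _ _ _ a0 c'0 KB).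
- by case: (cancel _ _ _ _ a'0 b'0 KC).
- by case: (cancel _ _ _ _ b0 c0 KA).
Qed.

End Cone.

(** * Normal cones of a triangle in the plane *)

Section Triangle.
Variable R : realType.

Lemma rowP2 (u v : 'rV[R]_2) : u 0 0 = v 0 0 -> u 0 1 = v 0 1 -> u = v.
Proof.
move=> h0 h1; apply/rowP => -[[|[|//]] i].
  by rewrite (_ : Ordinal _ = 0) //; apply/val_inj.
by rewrite (_ : Ordinal _ = 1) //; apply/val_inj.
Qed.

Lemma dot2E (u v : 'rV[R]_2) : dot u v = u 0 0 * v 0 0 + u 0 1 * v 0 1.
Proof.
rewrite /dot big_ord_recl big_ord1.
by congr (_ + u 0 _ * v 0 _); apply/val_inj.
Qed.

(** Cramer's rule gives the basis dual to [B - A], [C - A]; a zero determinant would make these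
    vectors proportional and the points collinear. *)
Lemma noncollinear_dual_basis (A B C : 'rV[R]_2) : A <> B ->
  ~ (exists L : set 'rV[R]_2, is_line L /\ [set A; B; C] `<=` L) ->
  exists e f : 'rV[R]_2,
    forall u, u = dot u (B - A) *: e + dot u (C - A) *: f.
Proof.
move=> AB nL; set b := B - A; set d := C - A.
have b0 : b != 0 by rewrite subr_eq0; apply/eqP => /esym.
have [det0|det0] := eqVneq (b 0 0 * d 0 1 - b 0 1 * d 0 0) 0; last first.
  pose D := b 0 0 * d 0 1 - b 0 1 * d 0 0.
  exists (\row_i (if i == 0 then d 0 1 / D else - d 0 0 / D)).
  exists (\row_i (if i == 0 then - b 0 1 / D else b 0 0 / D)).
  clearbody b d => u.
  by apply: rowP2; rewrite !dot2E !mxE /D /=; field.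
have [t dt] : exists t, d = t *: b.
  clearbody b d.
  have [b00|b00] := eqVneq (b 0 0) 0.
    have b01 : b 0 1 != 0.
      by apply: contra_neq b0 => b01; apply: rowP2; rewrite mxE.
    exists (d 0 1 / b 0 1); apply: rowP2; rewrite !mxE ?divfK// b00 mulr0.
    move: det0; rewrite b00 mul0r sub0r => /eqP; rewrite oppr_eq0 mulf_eq0.
    by rewrite (negbTE b01) => /eqP.
  exists (d 0 0 / b 0 0); apply: rowP2; rewrite !mxE ?divfK//.
  apply: (mulfI b00); have -> : b 0 0 * (d 0 0 / b 0 0 * b 0 1) = b 0 1 * d 0 0.
    by field.
  by apply/eqP; rewrite -subr_eq0 det0.
case: nL; exists [set A + s *: b | s in [set: R]]; split; first by exists A, b.
move=> _ [[->|->]|->].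
- by exists 0 => //; rewrite scale0r addr0.
- by exists 1 => //; rewrite scale1r addrC subrK.
- by exists t => //; rewrite -dt addrC subrK.
Qed.

(* The interior of the normal cone of the triangle [PQS] at [S]. *)
Definition peak (P Q S : 'rV[R]_2) : set 'rV[R]_2 :=
  [set u | dot u P < dot u S /\ dot u Q < dot u S].

(* In the proof, [na], [nb], [nc] are outer normals of the sides opposite to
   [A], [B], [C]; each [peak] set is the open cone spanned by two of them. *)
Lemma normal_cone_sub (A B C : 'rV[R]_2) (K : set 'rV[R]_2) : A <> B ->
  ~ (exists L : set 'rV[R]_2, is_line L /\ [set A; B; C] `<=` L) ->
  ~ K 0 -> (forall u v, K u -> K v -> K (u + v)) ->
  (forall t u, 0 < t -> K u -> K (t *: u)) ->
  K `&` peak B C A !=set0 -> K `&` peak A C B !=set0 ->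
  K `&` peak A B C !=set0 ->
  [\/ peak B C A `<=` K, peak A C B `<=` K | peak A B C `<=` K].
Proof.
move=> AB nL K0 KD KZ [uA [KA pA]] [uB [KB pB]] [uC [KC pC]].
have [e [f ef]] := noncollinear_dual_basis AB nL.
pose na := e + f; pose nb := - e; pose nc := - f.
(* At each vertex the coefficients are the differences of [dot u] from that vertex to the other two,
   which are positive on the peak. *)
have hA u : peak B C A u -> exists b c,
    [/\ 0 < b, 0 < c & u = b *: nb + c *: nc].
  move=> [uBA uCA]; exists (dot u (A - B)), (dot u (A - C)).
  split; rewrite ?dotDr ?dotNr ?subr_gt0// [LHS](ef u) !dotDr !dotNr.
  by apply/rowP => i; rewrite !mxE; ring.
have hB u : peak A C B u -> exists a c,
    [/\ 0 < a, 0 < c & u = a *: na + c *: nc].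
  move=> [uAB uCB]; exists (dot u (B - A)), (dot u (B - C)).
  split; rewrite ?dotDr ?dotNr ?subr_gt0// [LHS](ef u) !dotDr !dotNr.
  by apply/rowP => i; rewrite !mxE; ring.
have hC u : peak A B C u -> exists a b,
    [/\ 0 < a, 0 < b & u = a *: na + b *: nb].
  move=> [uAC uBC]; exists (dot u (C - A)), (dot u (C - B)).
  split; rewrite ?dotDr ?dotNr ?subr_gt0// [LHS](ef u) !dotDr !dotNr.
  by apply/rowP => i; rewrite !mxE; ring.
have n0 : na + nb + nc = 0 by apply/rowP => i; rewrite !mxE; ring.
have [b [c [b0 c0 uAE]]] := hA _ pA.
have [a [c' [a0 c'0 uBE]]] := hB _ pB.
have [a' [b' [a'0 b'0 uCE]]] := hC _ pC.
rewrite uAE in KA; rewrite uBE in KB; rewrite uCE in KC.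
have span (s t : R) (p q : 'rV[R]_2) :
    0 < s -> 0 < t -> K p -> K q -> K (s *: p + t *: q).
  by move=> s0 t0 Kp Kq; apply: KD; exact: KZ.
have [[Kb Kc]|[Ka Kc]|[Ka Kb]] :=
  cone_two_rays K0 KD KZ n0 a0 b0 c0 a'0 b'0 c'0 KA KB KC.
- by constructor 1 => u /hA[s [t [s0 t0 ->]]]; exact: span.
- by constructor 2 => u /hB[s [t [s0 t0 ->]]]; exact: span.
- by constructor 3 => u /hC[s [t [s0 t0 ->]]]; exact: span.
Qed.

(* The set [K] of directions in which the disc [x] sticks out of [y] is a
   convex cone because [r <= r']. *)
Lemma discs_in_triangle (A B C c c' : 'rV[R]_2) (r r' : R) : A <> B ->
  ~ (exists L : set 'rV[R]_2, is_line L /\ [set A; B; C] `<=` L) ->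
  0 <= r -> r <= r' ->
  let x := [set p | enorm (p - c) <= r] in
  let y := [set p | enorm (p - c') <= r'] in
  x `<=` convex_hull [set A; B; C] -> y `<=` convex_hull [set A; B; C] ->
  exists U V : 'rV[R]_2,
    [set A; B; C] U /\ [set A; B; C] V /\
    (x `<=` convex_hull (y `|` [set U; V]) \/
     y `<=` convex_hull (x `|` [set U; V])).
Proof.
move=> AB nL r0 rr' x y xT yT; apply: contrapT => nUV.
have r'0 := le_trans r0 rr'.
pose K : set 'rV[R]_2 := [set u | (r' - r) * enorm u < dot u (c - c')].
(* Failure of the first inclusion puts a peak direction in [K]. Failure of the second gives one with
   <u, c - c'> < (r' - r) |u|, hence outside [K]. *)
have escape U V W : [set A; B; C] U -> [set A; B; C] V ->
    [set A; B; C] `<=` [set U; V; W] ->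
    K `&` peak U V W !=set0 /\ ~ (peak U V W `<=` K).
  move=> TU TV TW; split.
    have [|u [uU uV uK]] :=
        disc_not_sub_hull r'0 TW xT (U := U) (V := V) (c' := c').
      by move=> xy; apply: nUV; exists U, V; do 2 split=> //; left.
    by exists u.
  have [|u [uU uV uK]] :=
      disc_not_sub_hull r0 TW yT (U := U) (V := V) (c' := c).
    by move=> yx; apply: nUV; exists U, V; do 2 split=> //; right.
  move=> /(_ u (conj uU uV)); rewrite /K/=; move: uK.
  by rewrite !dotDr !dotNr; lra.
have TA : [set A; B; C] A by left; left.
have TB : [set A; B; C] B by left; right.
have TC : [set A; B; C] C by right.
have [|KA nA] := escape B C A TB TC.
  by move=> p [[->|->]|->]; [right|left; left|left; right].
have [|KB nB] := escape A C B TA TC.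
  by move=> p [[->|->]|->]; [left; left|right|left; right].
have [//|KC nC] := escape A B C TA TB.
have [|||//|//|//] := normal_cone_sub AB nL (K := K) _ _ _ KA KB KC.
- by rewrite /K/= enorm0 mulr0 dot0l ltxx.
- move=> u v; rewrite /K/= dotDl => Ku Kv.
  rewrite (le_lt_trans _ (ltrD Ku Kv))// -mulrDr ler_wpM2l ?subr_ge0//.
  exact: enormD.
- move=> t u t0; rewrite /K/= enormZ dotZl gtr0_norm// mulrCA.
  by rewrite ltr_pM2l.
Qed.

End Triangle.

Theorem theorem3p1 (R : realType) (A B C : 'rV[R]_2) (x y : set 'rV[R]_2)
    (hAB : A <> B) (hAC : A <> C) (hBC : B <> C)
    (hABC : ~ exists L : set 'rV[R]_2, is_line L /\ [set A; B; C] `<=` L)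
    (hx : is_closed_disc x) (hy : is_closed_disc y)
    (hxABC : x `<=` convex_hull [set A; B; C])
    (hyABC : y `<=` convex_hull [set A; B; C]) :
  exists U V : 'rV[R]_2,
    [set A; B; C] U /\ [set A; B; C] V /\
    (x `<=` convex_hull (y `|` [set U; V]) \/
     y `<=` convex_hull (x `|` [set U; V])).
Proof.
move: hx hy hxABC hyABC => [c [r [r0 ->]]] [c' [r' [r'0 ->]]] xT yT.
(* The conclusion is symmetric in the discs, so the smaller one may come first. *)
have [rr'|/ltW r'r] := leP r r'; first exact: discs_in_triangle.
have [U [V [TU [TV xy]]]] := discs_in_triangle hAB hABC r'0 r'r yT xT.
by exists U, V; do 2 split=> //; rewrite or_comm.
Qed.
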